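(* Let $\delta$ be a real number with $0<\delta<2$. If $q\gg\ell^{2+\delta}$, then $\#\mathscr{E}(q,\ell)\ll q^{2-\delta/(2+\delta)}$. Explicitly: for every real $c>0$ there is a real constant $K>0$ (depending only on $\delta$ and $c$) such that for every prime number $\ell$ and every prime power $q$ with $\ell\mid q-1$ and $q\geqslant c\,\ell^{2+\delta}$, one has $$\#\mathscr{E}(q,\ell)\leqslant K\,q^{2-\frac{\delta}{2+\delta}} .$$
   Context: Let $\ell$ be a prime number and $q$ a prime power with $\ell\mid q-1$; $\mathbb{F}_q$ is the finite field with $q$ elements. For $A,B\in\mathbb{F}_q^\times$, let $C_{q,\ell}(A,B)\subset\mathbb{P}^2_{\mathbb{F}_q}$ be the projective plane curve $Ax^\ell+By^\ell=z^\ell$, and let $N_{q,\ell}(A,B)$ be the number of its $\mathbb{F}_q$-rational points, i.e. the number of points $[x:y:z]\in\mathbb{P}^2(\mathbb{F}_q)$ with $Ax^\ell+By^\ell=z^\ell$. Define $$\mathscr{E}(q,\ell):=\{(A,B)\in\mathbb{F}_q^\times\times\mathbb{F}_q^\times : N_{q,\ell}(A,B)=0\}.$$ The notation $f\ll g$ (equivalently $g\gg f$) means $f\leqslant K g$ for some positive constant $K$. *)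

(* Defs.v *)
From HB Require Import structures.
From mathcomp Require Import all_boot all_order all_algebra.
From mathcomp Require Import reals exp.

Set Implicit Arguments.
Unset Strict Implicit.
Unset Printing Implicit Defensive.

Import GRing.Theory.

Local Open Scope ring_scope.

Section FermatCurve.
Variable F : finFieldType.

(* The point [x : y : z] of P^2(F), as the set of all its representatives
   v = (x, y, z) in F^3; meaningful only for v != 0. *)
Definition proj_point (v : 'rV[F]_3) : {set 'rV[F]_3} :=
  [set k *: v | k : F & k != 0].

Definition on_curve (l : nat) (A B : F) (v : 'rV[F]_3) : bool :=
  let x := v ord0 (inord 0) in
  let y := v ord0 (inord 1) in
  let z := v ord0 (inord 2) in
  A * x ^+ l + B * y ^+ l == z ^+ l.

Lemma proj_point_eq (v w : 'rV[F]_3) :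
  reflect (exists2 k : F, k != 0 & w = k *: v) (proj_point v == proj_point w).
Proof.
apply: (iffP eqP) => [eq_vw | [k k0 ->]].
  have /imsetP[k] : w \in proj_point v.
    rewrite eq_vw; apply/imsetP; exists 1; last by rewrite scale1r.
    by rewrite inE oner_neq0.
  by rewrite inE => k0 ->; exists k.
apply/setP => u; apply/imsetP/imsetP => -[m]; rewrite inE => m0 ->.
  exists (m / k); last by rewrite scalerA divfK.
  by rewrite inE mulf_neq0 ?invr_eq0.
by exists (m * k); [rewrite inE mulf_neq0 | rewrite scalerA].
Qed.

Lemma on_curveZ (l : nat) (A B k : F) (v : 'rV[F]_3) :
  k != 0 -> on_curve l A B (k *: v) = on_curve l A B v.
Proof.
move=> k0; rewrite /on_curve !mxE !exprMn !(mulrCA _ (k ^+ l)) -mulrDr.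
by apply/eqP/eqP => [|->//]; apply: mulfI; rewrite expf_neq0.
Qed.

Definition curve_points (l : nat) (A B : F) : {set {set 'rV[F]_3}} :=
  [set proj_point v | v : 'rV[F]_3 & (v != 0) && on_curve l A B v].

Definition num_points (l : nat) (A B : F) : nat := #|curve_points l A B|.

Definition exceptional_pairs (l : nat) : {set F * F} :=
  [set AB : F * F |
    [&& AB.1 != 0, AB.2 != 0 & num_points l AB.1 AB.2 == 0%N]].

End FermatCurve.

Arguments exceptional_pairs F l : clear implicits.

(* Main.v *)
Require Import Defs.
From HB Require Import structures.
From mathcomp Require Import all_boot all_order all_algebra.
From mathcomp Require Import reals exp.
From mathcomp Require Import ring lra zify.

Set Implicit Arguments.
Unset Strict Implicit.
Unset Printing Implicit Defensive.

Import Order.TTheory GRing.Theory Num.Theory.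

Local Open Scope ring_scope.

(** Let q = #|F| and let L be the set of pairs (x ^ l, y ^ l) with x, y nonzero.
    A pair (A, B) with A * x ^ l + B * y ^ l = 1 has the point [x : y : 1] on its
    curve, so an exceptional pair lies on none of the lines
    u * A + v * B = 1, (u, v) \in L, of the (A, B)-plane.

    A point set P that misses a family L of such lines satisfies
    #|P| * #|L| <= q ^ 3 ([no_incidence_card]).  This is a second moment
    argument: each line has q points and two distinct ones share at most one
    point, so the number of lines through a uniformly random point of the plane
    has mean #|L| / q and variance at most #|L| / q; at a point of P it is 0, so it
    deviates from its mean by the whole mean, and Chebyshev's inequality bounds
    the number of such points.

    An element has at most l l-th roots, so #|L| >= ((q - 1) / l) ^ 2
    ([card_nonzero_le_powers]).  As q - 1 >= q / 2, the number of exceptional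
    pairs is at most 4 * q * l ^ 2.  The hypothesis on q bounds l ^ 2 by a
    multiple of q ^ (2 / (2 + delta)), and
    1 + 2 / (2 + delta) = 2 - delta / (2 + delta). *)

Section FiniteFieldPlane.
Variable F : finFieldType.
Implicit Types (p w : F * F) (P L : {set F * F}).

Definition on_line p w : bool := w.1 * p.1 + w.2 * p.2 == 1.

Lemma card_line w : w != 0 -> #|[set p | on_line p w]| = #|F|.
Proof.
case: w => u v w0; have [u0 | u0] := eqVneq u 0.
  have v0 : v != 0 by apply: contraNneq w0 => ->; rewrite u0.
  rewrite -(card_imset _ (f := fun x : F => (x, v^-1))) => [|x y []//].
  apply: eq_card => -[a b]; rewrite !inE /on_line /= u0 mul0r add0r.
  apply/eqP/imsetP => [vb | [x _ [_ ->]]]; last by rewrite divff.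
  by exists a => //; congr pair; rewrite -[b](mulKf v0) vb mulr1.
rewrite -(card_imset _ (f := fun y : F => (u^-1 * (1 - v * y), y))) => [|x y []//].
apply: eq_card => -[a b]; rewrite !inE /on_line /=.
apply/eqP/imsetP => [uab | [y _ [-> ->]]]; last by rewrite mulVKf ?subrK.
by exists b => //; congr pair; rewrite -uab addrK mulKf.
Qed.

(** Two equations with vanishing determinant define either the same line or
    parallel ones; otherwise Cramer's rule determines the common point. *)
Lemma card_two_lines w w' : w != w' ->
  (#|[set p | on_line p w && on_line p w']| <= 1)%N.
Proof.
case: w w' => u v [u' v'] ww'; apply/card_le1_eqP => -[a b] [a' b'].
rewrite !inE /on_line /= => /andP[/eqP e1 /eqP e2] /andP[/eqP e3 /eqP e4].
have [det0 | det_neq0] := eqVneq (u * v' - v * u') 0.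
  case/negP: ww'; apply/eqP; congr pair.
    have : u * (u' * a + v' * b) - u' * (u * a + v * b)
           = (u * v' - v * u') * b by ring.
    by rewrite e1 e2 det0 mul0r !mulr1 => /eqP; rewrite subr_eq0 => /eqP.
  have : v' * (u * a + v * b) - v * (u' * a + v' * b)
         = (u * v' - v * u') * a by ring.
  by rewrite e1 e2 det0 mul0r !mulr1 => /eqP; rewrite subr_eq0 => /eqP.
congr pair; apply: (mulfI det_neq0).
  have -> : (u * v' - v * u') * a
         = v' * (u * a + v * b) - v * (u' * a + v' * b) by ring.
  rewrite e1 e2; transitivity (v' * (u * a' + v * b') - v * (u' * a' + v' * b')).
    by ring.
  by rewrite e3 e4.
have -> : (u * v' - v * u') * b
       = u * (u' * a + v' * b) - u' * (u * a + v * b) by ring.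
rewrite e1 e2; transitivity (u * (u' * a' + v' * b') - u' * (u * a' + v * b')).
  by ring.
by rewrite e3 e4.
Qed.

Definition num_lines_through L p : nat := #|[set w in L | on_line p w]|.

Lemma num_lines_throughE L p : num_lines_through L p = (\sum_(w in L) on_line p w)%N.
Proof.
rewrite /num_lines_through -sum1_card big_mkcond [RHS]big_mkcond /=.
by apply: eq_bigr => w _; rewrite inE; case: (w \in L); case: on_line.
Qed.

Lemma sum_num_lines_through L : 0 \notin L ->
  (\sum_p num_lines_through L p = #|L| * #|F|)%N.
Proof.
move=> L0; under eq_bigr do rewrite num_lines_throughE.
rewrite exchange_big /= -sum_nat_const; apply: eq_bigr => w wL.
rewrite -(card_line (w := w)); last by apply: contraNneq L0 => <-.
by rewrite -sum1dep_card [RHS]big_mkcond; apply: eq_bigr => p _; case: on_line.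
Qed.

(** The square counts pairs of lines through a point: the diagonal pairs
    contribute [#|F|] each, the others at most 1 each. *)
Lemma sum_sqr_num_lines_through L : 0 \notin L ->
  (\sum_p num_lines_through L p ^ 2 <= #|L| * #|F| + #|L| ^ 2)%N.
Proof.
move=> L0.
have -> : (\sum_p num_lines_through L p ^ 2 =
  \sum_(w in L) \sum_(w' in L) #|[set p | on_line p w && on_line p w']|)%N.
  rewrite (eq_bigr (fun p => \sum_(w in L) \sum_(w' in L)
      (on_line p w && on_line p w' : nat))%N) => [|p _].
    rewrite exchange_big; apply: eq_bigr => w _; rewrite exchange_big.
    apply: eq_bigr => w' _; rewrite -sum1dep_card [RHS]big_mkcond.
    by apply: eq_bigr => p _; case: andb.
  rewrite -mulnn num_lines_throughE big_distrlr /=.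
  by apply: eq_bigr => w _; apply: eq_bigr => w' _; rewrite mulnb.
rewrite -mulnn -mulnDr -sum_nat_const; apply: leq_sum => w wL.
rewrite (bigD1 w) //=; apply: leq_add.
  rewrite -(card_line (w := w)); last by apply: contraNneq L0 => <-.
  by apply: subset_leq_card; apply/subsetP => p; rewrite !inE andbb.
rewrite -sum1_card [leqRHS](bigD1 w) //=; apply: leq_trans (leq_addl _ _).
by apply: leq_sum => w' /andP[_ ww']; apply: card_two_lines; rewrite eq_sym.
Qed.

(** Chebyshev's inequality for [num_lines_through L], whose mean #|L| / #|F| is
    cleared of its denominator to stay in the integers. *)
Lemma no_incidence_card P L : 0 \notin L ->
  {in P & L, forall p w, ~~ on_line p w} -> (#|P| * #|L| <= #|F| ^ 3)%N.
Proof.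
move=> L0 PL; have [-> | L_gt0] := posnP #|L|; first by rewrite muln0.
pose q : int := #|F|%:R; pose n : int := #|L|%:R.
pose M p : int := (num_lines_through L p)%:R.
have S1 : \sum_p M p = n * q.
  by rewrite /M -natr_sum sum_num_lines_through // natrM.
have S2 : \sum_p M p ^+ 2 <= n * q + n ^+ 2.
  rewrite /n /q -natrM -natrX -natrD.
  under eq_bigr do rewrite /M -natrX.
  by rewrite -natr_sum ler_nat sum_sqr_num_lines_through.
have var_le : \sum_p (q * M p - n) ^+ 2 <= q ^+ 3 * n.
  have -> : \sum_p (q * M p - n) ^+ 2 =
      q ^+ 2 * (\sum_p M p ^+ 2) - q * n *+ 2 * (\sum_p M p) + q ^+ 2 * n ^+ 2.
    transitivity (\sum_p (q ^+ 2 * M p ^+ 2 + - (q * n *+ 2) * M p + n ^+ 2)).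
      by apply: eq_bigr => p _; ring.
    rewrite !big_split /= -!mulr_sumr sumr_const card_prod -[n *+ _]mulr_natl natrM.
    by rewrite mulNr /q; ring.
  have q2_ge0 : 0 <= q ^+ 2 by apply: sqr_ge0.
  rewrite S1; have := ler_wpM2l q2_ge0 S2; rewrite mulrDr; lra.
have P_le : #|P|%:R * n ^+ 2 <= \sum_p (q * M p - n) ^+ 2.
  rewrite (bigID (mem P)) /= mulr_natl -sumr_const -[leLHS]addr0.
  apply: lerD; last by apply: sumr_ge0 => p _; apply: sqr_ge0.
  apply: ler_sum => p pP; rewrite [M p](_ : _ = 0) ?mulr0 ?sub0r ?sqrrN //.
  rewrite /M num_lines_throughE big1 // => w wL.
  by rewrite (negbTE (PL p w pP wL)).
have n_gt0 : 0 < n by rewrite ltr0n.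
rewrite -(ler_nat int) natrM natrX -(ler_pM2r n_gt0) -mulrA -expr2.
exact: le_trans P_le var_le.
Qed.

Definition nonzero_powers (l : nat) : {set F} := [set x ^+ l | x : F & x != 0].

(** The fibres of [x |-> x ^+ l] are the root sets of the polynomials
    'X^l - a, so they have at most l elements. *)
Lemma card_nonzero_le_powers l : (0 < l)%N ->
  (#|F|.-1 <= #|nonzero_powers l| * l)%N.
Proof.
move=> l_gt0.
have -> : #|F|.-1 = #|[set x : F | x != 0]|.
  by rewrite cardsE -(cardC1 (0 : F)).
rewrite -sum1_card (partition_big_imset (fun x => x ^+ l)) /= -sum_nat_const.
apply: leq_sum => a _; rewrite sum1dep_card cardE.
have Xl_a0 : 'X^l - a%:P != 0 :> {poly F} by rewrite -size_poly_gt0 size_XnsubC.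
rewrite -ltnS -(size_XnsubC a l_gt0) max_poly_roots ?enum_uniq //.
apply/allP => x; rewrite mem_enum !inE => /andP[_ /eqP <-].
by rewrite rootE !hornerE subrr.
Qed.

Lemma exceptional_pair_off_line l (p : F * F) x y :
  p \in exceptional_pairs F l -> ~~ on_line p (x ^+ l, y ^+ l).
Proof.
rewrite inE cards_eq0 => /and3P[_ _ /eqP no_pt]; apply/negP => /eqP /= xy.
pose v : 'rV[F]_3 := \row_i [:: x; y; 1]`_i.
have : proj_point v \in curve_points l p.1 p.2.
  apply/imsetP; exists v => //; rewrite inE; apply/andP; split.
    apply/eqP => /rowP/(_ (inord 2)); rewrite !mxE inordK //= => /eqP.
    by rewrite oner_eq0.
  by rewrite /on_curve !mxE !inordK //= expr1n -xy [x ^+ l * _]mulrC [y ^+ l * _]mulrC.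
by rewrite no_pt inE.
Qed.

Lemma card_exceptional_pairs l : (0 < l)%N ->
  (#|exceptional_pairs F l| <= 4 * #|F| * l ^ 2)%N.
Proof.
move=> l_gt0; set E := exceptional_pairs F l; set H := nonzero_powers l.
have L0 : 0 \notin setX H H.
  rewrite inE /=; apply/nandP; left; apply/imsetP => -[x]; rewrite inE => x0 /esym/eqP.
  by rewrite expf_eq0 (negbTE x0) andbF.
have inc : (#|E| * (#|H| * #|H|) <= #|F| ^ 3)%N.
  rewrite -cardsX; apply: no_incidence_card => // p [u v] pE.
  rewrite inE /= => /andP[/imsetP[x _ ->] /imsetP[y _ ->]].
  exact: exceptional_pair_off_line.
have H_ge := card_nonzero_le_powers l_gt0; rewrite -/H in H_ge.
have q_gt1 : (1 < #|F|)%N by apply: card_finNzRing_gt1.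
have q_le : (#|F| <= 2 * (#|H| * l))%N by lia.
have q2_gt0 : (0 < #|F| ^ 2)%N by rewrite expn_gt0; lia.
(* The incidence bound gives #|E| * q ^ 2 <= 4 * l ^ 2 * q ^ 3. *)
rewrite -(leq_pmul2r q2_gt0).
apply: (@leq_trans (#|E| * (2 * (#|H| * l)) ^ 2)).
  by rewrite leq_mul2l leq_sqr q_le orbT.
have -> : (#|E| * (2 * (#|H| * l)) ^ 2 = 4 * l ^ 2 * (#|E| * (#|H| * #|H|)))%N by ring.
have -> : (4 * #|F| * l ^ 2 * #|F| ^ 2 = 4 * l ^ 2 * #|F| ^ 3)%N by ring.
by rewrite leq_mul2l inc orbT.
Qed.

End FiniteFieldPlane.

Theorem theorem1 (R : realType) (delta : R) (delta_gt0 : 0 < delta)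
    (delta_lt2 : delta < 2) (c : R) (c_gt0 : 0 < c) :
  exists2 K : R, 0 < K &
    forall (l : nat) (F : finFieldType),
      prime l -> (l %| #|F| - 1)%N ->
      c * l%:R `^ (2 + delta) <= #|F|%:R ->
      #|exceptional_pairs F l|%:R <= K * #|F|%:R `^ (2 - delta / (2 + delta)).
Proof.
pose s := 2 / (2 + delta).
exists (4 * c^-1 `^ s) => [|l F l_prime _ q_ge].
  by rewrite mulr_gt0 ?powR_gt0 ?invr_gt0.
have s_neq0 : 2 + delta != 0 by lra.
have q_gt0 : 0 < #|F|%:R :> R by rewrite ltr0n ltnW ?card_finNzRing_gt1.
have [c_ge0 q_ge0] := (ltW c_gt0, ltW q_gt0).
have l2_le : l%:R ^+ 2 <= c^-1 `^ s * #|F|%:R `^ s :> R.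
  rewrite -powRM ?invr_ge0 // -powR_mulrn ?ler0n //.
  have -> : 2%:R = (2 + delta) * s by rewrite /s mulrC divfK.
  rewrite powRrM; apply: ge0_ler_powR.
  - by rewrite divr_ge0 //; lra.
  - by rewrite nnegrE powR_ge0.
  - by rewrite nnegrE mulr_ge0 ?invr_ge0.
  - by rewrite mulrC ler_pdivlMr // mulrC.
have -> : 2 - delta / (2 + delta) = 1 + s by rewrite /s; field.
rewrite powRD ?(gt_eqF q_gt0) ?implybT // powRr1 //.
have := card_exceptional_pairs F (prime_gt0 l_prime).
rewrite -(ler_nat R) natrM natrX natrM => /le_trans; apply.
have -> : 4 * c^-1 `^ s * (#|F|%:R * #|F|%:R `^ s)
  = 4 * #|F|%:R * (c^-1 `^ s * #|F|%:R `^ s) by ring.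
by rewrite ler_wpM2l // mulr_ge0.
Qed.
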